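(* Let $R$ be a proper simple semiring. If $R$ has an infinite element or a projective minimal left ideal, then $R$ is not left perfect. Likewise, if $R$ has an infinite element or a projective minimal right ideal, then $R$ is not right perfect.
   Context: A semiring $(R,+,\cdot,0,1)$ consists of a commutative monoid $(R,+,0)$ and a monoid $(R,\cdot,1)$ such that multiplication distributes over addition on both sides and $0r=0=r0$ for all $r\in R$; it is proper if it is not a ring. An ideal (left, right ideal) is an additive submonoid closed under two-sided (left, right) multiplication by elements of $R$. $R$ is ideal-simple if $0$ and $R$ are its only ideals; congruence-simple if the diagonal and $R^2$ are its only congruences; simple if it is both. An infinite element is an element $\infty\in R$ with $r+\infty=\infty$ for all $r\in R$. A left $R$-semimodule is a commutative monoid $M$ with a unital, associative scalar multiplication $R\times M\to M$ that is additive in each variable and satisfies $r0_M=0_M=0m$ (right semimodules dually). A semimodule is free if it is a direct sum of copies of the regular semimodule, and projective if it is a retract of a free semimodule. A minimal left (right) ideal is a nonzero left (right) ideal containing no nonzero left (right) ideal properly; it is projective if it is projective as a left (right) $R$-semimodule. A left (right) semimodule is flat if it is a filtered (directed) colimit of finitely generated free semimodules (equivalently, tensoring with it preserves finite limits). $R$ is left (right) perfect if every flat left (right) $R$-semimodule is projective. *)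

(* Defs.v *)
From Stdlib Require List.
From HB Require Import structures.
From mathcomp Require Import all_boot ssralg.
From mathcomp Require Import boolp.

Set Implicit Arguments.
Unset Strict Implicit.
Unset Printing Implicit Defensive.

Import GRing.Theory.

Local Open Scope ring_scope.

Section SemiringNotions.
Variable R : pzSemiRingType.

Definition proper_semiring : Prop := ~ forall x : R, exists y : R, x + y = 0.

Definition ideal (I : {pred R}) : Prop :=
  GRing.nmod_closed I /\
  (forall a x : R, x \in I -> (a * x \in I) /\ (x * a \in I)).

Definition ideal_simple : Prop :=
  forall I : {pred R}, ideal I -> I =i pred1 0 \/ I =i predT.

Definition congruence (r : R -> R -> Prop) : Prop :=
  [/\ (forall x, r x x),
      (forall x y, r x y -> r y x),
      (forall x y z, r x y -> r y z -> r x z),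
      (forall x y x' y', r x y -> r x' y' -> r (x + x') (y + y')) &
      (forall x y x' y', r x y -> r x' y' -> r (x * x') (y * y'))].

Definition congruence_simple : Prop :=
  forall r : R -> R -> Prop, congruence r ->
    (forall x y, r x y <-> x = y) \/ (forall x y, r x y).

Definition simple_semiring : Prop := ideal_simple /\ congruence_simple.

Definition infinite_element (w : R) : Prop := forall x : R, x + w = w.

End SemiringNotions.

(* Semimodules are left semimodules (lSemiModType R); right R-semimodules are *)
(* left semimodules over the converse semiring R^c.  A left ideal of R is a   *)
(* subsemimodule of R^o (submodClosed R^o), a right ideal one of (R^c)^o.     *)

Section Subsemimodule.
Variables (R : pzSemiRingType) (V : lSemiModType R) (S : submodClosed V).

Record subsemimod := Subsemimod {
  subsemimod_val :> V;
  _ : subsemimod_val \in S }.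

HB.instance Definition _ := [isSub for subsemimod_val].
HB.instance Definition _ := [Choice of subsemimod by <:].
HB.instance Definition _ := [SubChoice_isSubLSemiModule of subsemimod by <:].

End Subsemimodule.

(* The direct sum of copies of R^o indexed by an arbitrary type X: functions  *)
(* X -> R with finite support and pointwise operations.                       *)
Section DirectSum.
Variables (R : pzSemiRingType) (X : Type).

Definition finite_support (f : X -> R) : Prop :=
  exists s : seq X, forall x, f x <> 0 -> List.In x s.

Record dsum := Dsum {
  dsum_val :> X -> R;
  _ : `[< finite_support dsum_val >] }.

HB.instance Definition _ := [isSub for dsum_val].
HB.instance Definition _ := [Choice of dsum by <:].

Lemma dsumP (f g : dsum) : (forall x, f x = g x) -> f = g.
Proof. by move=> fg; apply: val_inj; apply: funext. Qed.

Lemma dsum_supp (f : dsum) : finite_support f.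
Proof. by case: f => f /= /asboolP. Qed.

Lemma dsum0_subproof : `[< finite_support (fun _ => 0) >].
Proof. by apply/asboolP; exists [::]. Qed.

Lemma dsumD_subproof (f g : dsum) : `[< finite_support (fun x => f x + g x) >].
Proof.
apply/asboolP; have [s fs] := dsum_supp f; have [t gt] := dsum_supp g.
exists (s ++ t) => x fgx; apply/List.in_or_app.
have [fx0|/eqP fx0] := eqVneq (f x) 0; last by left; exact: fs.
by right; apply: gt => gx0; apply: fgx; rewrite fx0 gx0 addr0.
Qed.

Lemma dsumZ_subproof (a : R) (f : dsum) : `[< finite_support (fun x => a * f x) >].
Proof.
apply/asboolP; have [s fs] := dsum_supp f.
by exists s => x afx; apply: fs => fx0; apply: afx; rewrite fx0 mulr0.
Qed.

Definition dsum_zero := Dsum dsum0_subproof.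
Definition dsum_add f g := Dsum (dsumD_subproof f g).
Definition dsum_scale a f := Dsum (dsumZ_subproof a f).

Lemma dsum_addA : associative dsum_add.
Proof. by move=> f g h; apply: dsumP => x /=; rewrite addrA. Qed.
Lemma dsum_addC : commutative dsum_add.
Proof. by move=> f g; apply: dsumP => x /=; rewrite addrC. Qed.
Lemma dsum_add0 : left_id dsum_zero dsum_add.
Proof. by move=> f; apply: dsumP => x /=; rewrite add0r. Qed.

HB.instance Definition _ :=
  GRing.isNmodule.Build dsum dsum_addA dsum_addC dsum_add0.

Lemma dsum_scaleA a b f : dsum_scale a (dsum_scale b f) = dsum_scale (a * b) f.
Proof. by apply: dsumP => x /=; rewrite mulrA. Qed.
Lemma dsum_scale0 f : dsum_scale 0 f = 0.
Proof. by apply: dsumP => x /=; rewrite mul0r. Qed.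
Lemma dsum_scale1 : left_id 1 dsum_scale.
Proof. by move=> f; apply: dsumP => x /=; rewrite mul1r. Qed.
Lemma dsum_scaleDr a : {morph dsum_scale a : f g / f + g}.
Proof. by move=> f g; apply: dsumP => x /=; rewrite mulrDr. Qed.
Lemma dsum_scaleDl f : {morph dsum_scale^~ f : a b / a + b}.
Proof. by move=> a b; apply: dsumP => x /=; rewrite mulrDl. Qed.

HB.instance Definition _ := GRing.Nmodule_isLSemiModule.Build R dsum
  dsum_scaleA dsum_scale0 dsum_scale1 dsum_scaleDr dsum_scaleDl.

End DirectSum.

Section SemimoduleNotions.
Variable R : pzSemiRingType.

(* A bijective linear map is an isomorphism: its inverse is linear. *)
Definition free_semimod (M : lSemiModType R) : Prop :=
  exists (X : Type) (f : {linear M -> dsum R X}), bijective f.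

Definition finitely_generated (M : lSemiModType R) : Prop :=
  exists (n : nat) (e : 'I_n -> M), forall m : M,
    exists a : 'I_n -> R, m = \sum_(i < n) a i *: e i.

Definition projective (P : lSemiModType R) : Prop :=
  exists (F : lSemiModType R) (s : {linear P -> F}) (p : {linear F -> P}),
    free_semimod F /\ cancel s p.

(* The comparison maps ds_map h do not depend on the proof h of i <= j: this  *)
(* follows from ds_map_id and ds_map_comp.                                    *)
Record directed_system := DirectedSystem {
  ds_index : Type;
  ds_le : ds_index -> ds_index -> Prop;
  ds_le_refl : forall i, ds_le i i;
  ds_le_trans : forall i j k, ds_le i j -> ds_le j k -> ds_le i k;
  ds_inhabited : inhabited ds_index;
  ds_directed : forall i j, exists k, ds_le i k /\ ds_le j k;
  ds_obj : ds_index -> lSemiModType R;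
  ds_map : forall i j, ds_le i j -> {linear ds_obj i -> ds_obj j};
  ds_map_id : forall i (h : ds_le i i) x, ds_map h x = x;
  ds_map_comp : forall i j k (hij : ds_le i j) (hjk : ds_le j k)
    (hik : ds_le i k) x, ds_map hjk (ds_map hij x) = ds_map hik x }.

Definition cocone (D : directed_system) (M : lSemiModType R)
    (c : forall i : ds_index D, {linear ds_obj i -> M}) : Prop :=
  forall i j (h : ds_le i j) x, c j (ds_map h x) = c i x.

Definition is_colimit (D : directed_system) (M : lSemiModType R)
    (c : forall i : ds_index D, {linear ds_obj i -> M}) : Prop :=
  cocone c /\
  forall (N : lSemiModType R) (g : forall i : ds_index D, {linear ds_obj i -> N}),
    cocone g ->
    exists u : {linear M -> N}, (forall i x, u (c i x) = g i x) /\
      (forall v : {linear M -> N}, (forall i x, v (c i x) = g i x) -> v =1 u).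

Definition flat (M : lSemiModType R) : Prop :=
  exists (D : directed_system) (c : forall i : ds_index D, {linear ds_obj i -> M}),
    (forall i : ds_index D,
        free_semimod (ds_obj i) /\ finitely_generated (ds_obj i)) /\
    is_colimit c.

Definition minimal_left_ideal (I : submodClosed R^o) : Prop :=
  (exists2 x, x \in I & x != 0) /\
  forall J : submodClosed R^o, (exists2 x, x \in J & x != 0) ->
    {subset J <= I} -> J =i I.

Definition left_perfect : Prop :=
  forall M : lSemiModType R, flat M -> projective M.

End SemimoduleNotions.

Definition minimal_right_ideal (R : pzSemiRingType)
  (I : submodClosed (R^c)^o) : Prop := @minimal_left_ideal R^c I.

Definition right_perfect (R : pzSemiRingType) : Prop := left_perfect R^c.

(* Main.v *)
(** The additively invertible elements form an ideal, so [R] is zerosumfree and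
    nontrivial, since it is proper.  The semimodule of eventually constant
    sequences in [R] is the union of the free semimodules of sequences constant
    from [n] on, hence flat.  If it were a retract, via [s] and [p], of a direct
    sum of copies of [R], then, as the indicator [e_n] of [{n}] is a summand of
    the constant sequence [1], zerosumfreeness would put the support of each
    [s e_n] inside the finite support of [s 1].  So [p] would map all the [s e_n]
    into a finitely generated subsemimodule, whose elements are all constant from
    a common rank [N] on; but [p (s e_N) = e_N] is not. *)
From HB Require Import structures.
Require Import Defs.
From mathcomp Require Import all_boot ssralg.
From mathcomp Require Import boolp.

Set Implicit Arguments.
Unset Strict Implicit.
Unset Printing Implicit Defensive.

Import GRing.Theory.

Local Open Scope ring_scope.

(** * Zerosumfreeness from ideal-simplicity *)

Definition zerosumfree (R : nmodType) : Prop :=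
  forall x y : R, x + y = 0 -> x = 0.

Lemma proper_ideal_simple_zerosumfree (R : pzSemiRingType) :
  proper_semiring R -> ideal_simple R -> zerosumfree R.
Proof.
move=> Rproper Rsimple x y xy0.
pose V : {pred R} := fun a => `[< exists b, a + b = 0 >].
have VP a : reflect (exists b, a + b = 0) (a \in V) by apply: asboolP.
have idealV : ideal V.
  split; first split=> [|a b /VP[a' aa'] /VP[b' bb']].
  - by apply/VP; exists 0; rewrite addr0.
  - by apply/VP; exists (a' + b'); rewrite addrACA aa' bb' addr0.
  move=> a b /VP[b' bb']; split; apply/VP.
    by exists (a * b'); rewrite -mulrDr bb' mulr0.
  by exists (b' * a); rewrite -mulrDl bb' mul0r.
(* If [V] is zero, then [x], whose opposite is [y], vanishes; if [V] is everything, then [R] is a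
   ring. *)
case: (Rsimple V idealV) => [V0|VT].
  by apply/eqP; rewrite -[_ == _]V0; apply/VP; exists y.
by case: Rproper => a; apply/VP; rewrite VT.
Qed.

Section EventuallyConstant.
Variable R : pzSemiRingType.

(** * The semimodule of eventually constant sequences *)

Definition constant_from n (f : nat -> R) : Prop :=
  forall m, (n <= m)%N -> f m = f n.

Lemma constant_fromW n m f :
  (n <= m)%N -> constant_from n f -> constant_from m f.
Proof. by move=> nm fn k mk; rewrite !fn // (leq_trans nm). Qed.

Lemma constant_fromD n f g : constant_from n f -> constant_from n g ->
  constant_from n (fun i => f i + g i).
Proof. by move=> fn gn m nm; rewrite fn ?gn. Qed.

Lemma constant_fromZ n a f :
  constant_from n f -> constant_from n (fun i => a * f i).
Proof. by move=> fn m nm; rewrite fn. Qed.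

Definition eventually_constant (f : nat -> R) : Prop :=
  exists n, constant_from n f.

Record evconst := Evconst {
  evconst_val :> nat -> R;
  _ : `[< eventually_constant evconst_val >] }.

HB.instance Definition _ := [isSub for evconst_val].
HB.instance Definition _ := [Choice of evconst by <:].

Lemma evconstP (f : evconst) : eventually_constant f.
Proof. by case: f => f /= /asboolP. Qed.

Lemma evconst_ext (f g : evconst) : f =1 g -> f = g.
Proof. by move=> fg; apply/val_inj/funext. Qed.

Lemma evconst0_subproof : `[< eventually_constant (fun=> 0) >].
Proof. by apply/asboolP; exists 0%N. Qed.

Lemma evconstD_subproof (f g : evconst) :
  `[< eventually_constant (fun i => f i + g i) >].
Proof.
have [[n fn] [m gm]] := (evconstP f, evconstP g).
apply/asboolP; exists (maxn n m); apply: constant_fromD.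
  exact: constant_fromW (leq_maxl _ _) fn.
exact: constant_fromW (leq_maxr _ _) gm.
Qed.

Lemma evconstZ_subproof a (f : evconst) :
  `[< eventually_constant (fun i => a * f i) >].
Proof.
have [n fn] := evconstP f.
by apply/asboolP; exists n; apply: constant_fromZ.
Qed.

Definition evconst_zero := Evconst evconst0_subproof.
Definition evconst_add f g := Evconst (evconstD_subproof f g).
Definition evconst_scale a f := Evconst (evconstZ_subproof a f).

Lemma evconst_addA : associative evconst_add.
Proof. by move=> f g h; apply: evconst_ext => i /=; rewrite addrA. Qed.
Lemma evconst_addC : commutative evconst_add.
Proof. by move=> f g; apply: evconst_ext => i /=; rewrite addrC. Qed.
Lemma evconst_add0 : left_id evconst_zero evconst_add.
Proof. by move=> f; apply: evconst_ext => i /=; rewrite add0r. Qed.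

HB.instance Definition _ :=
  GRing.isNmodule.Build evconst evconst_addA evconst_addC evconst_add0.

Lemma evconst_scaleA a b f :
  evconst_scale a (evconst_scale b f) = evconst_scale (a * b) f.
Proof. by apply: evconst_ext => i /=; rewrite mulrA. Qed.
Lemma evconst_scale0 f : evconst_scale 0 f = 0.
Proof. by apply: evconst_ext => i /=; rewrite mul0r. Qed.
Lemma evconst_scale1 : left_id 1 evconst_scale.
Proof. by move=> f; apply: evconst_ext => i /=; rewrite mul1r. Qed.
Lemma evconst_scaleDr a : {morph evconst_scale a : f g / f + g}.
Proof. by move=> f g; apply: evconst_ext => i /=; rewrite mulrDr. Qed.
Lemma evconst_scaleDl f : {morph evconst_scale^~ f : a b / a + b}.
Proof. by move=> a b; apply: evconst_ext => i /=; rewrite mulrDl. Qed.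

HB.instance Definition _ := GRing.Nmodule_isLSemiModule.Build R evconst
  evconst_scaleA evconst_scale0 evconst_scale1 evconst_scaleDr evconst_scaleDl.

(** * Sequences constant from a given rank, as finite free semimodules *)

Lemma finite_support_ord n (f : 'I_n -> R) : `[< finite_support f >].
Proof.
apply/asboolP; exists (enum 'I_n) => i _; have: i \in enum 'I_n by rewrite mem_enum.
elim: (enum 'I_n) => //= j s IHs; rewrite in_cons.
by case/orP=> [/eqP->|/IHs]; [left | right].
Qed.

(** The [n.+1] coordinates are the entries before [n], then the entry at [n], which stands for the
    whole tail when [f] is constant from [n]. *)
Definition truncate n (f : evconst) : dsum R 'I_n.+1 :=
  Dsum (finite_support_ord (fun i => f i)).

(** Capping the index by [minn i n] repeats the last coordinate forever and keeps [inord] within its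
    range, away from its default value. *)
Lemma extend_subproof n (f : dsum R 'I_n.+1) :
  `[< eventually_constant (fun i => f (inord (minn i n))) >].
Proof.
apply/asboolP; exists n => m nm.
by rewrite minnn (minn_idPr nm).
Qed.

Definition extend n (f : dsum R 'I_n.+1) : evconst :=
  Evconst (extend_subproof f).

Lemma truncate_semilinear n : semilinear (@truncate n).
Proof. by split=> [a f|f g]; apply: dsumP. Qed.

HB.instance Definition _ n := GRing.isSemilinear.Build R evconst
  (dsum R 'I_n.+1) _ (@truncate n) (@truncate_semilinear n).

Lemma extend_semilinear n : semilinear (@extend n).
Proof. by split=> [a f|f g]; apply: evconst_ext. Qed.

HB.instance Definition _ n := GRing.isSemilinear.Build R (dsum R 'I_n.+1)
  evconst _ (@extend n) (@extend_semilinear n).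

Lemma extendK n : cancel (@extend n) (@truncate n).
Proof.
move=> f; apply: dsumP => i /=.
by rewrite (minn_idPl _) ?inord_val // -ltnS.
Qed.

Lemma truncateK n (f : evconst) :
  constant_from n f -> extend (truncate n f) = f.
Proof.
move=> fn; apply: evconst_ext => i /=; rewrite inordK ?ltnS ?geq_minr //.
by case: (leqP i n) => // /ltnW/fn.
Qed.

Lemma constant_from_extend n m (f : dsum R 'I_n.+1) :
  (n <= m)%N -> constant_from m (extend f).
Proof.
move=> nm; apply: constant_fromW nm _ => k nk /=.
by rewrite minnn (minn_idPr nk).
Qed.

(** * Eventually constant sequences as a directed colimit *)

Definition evconst_map n m (_ : (n <= m)%N) :
  {linear dsum R 'I_n.+1 -> dsum R 'I_m.+1} := @truncate m \o @extend n.

Lemma evconst_map_id n (h : (n <= n)%N) f : evconst_map h f = f.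
Proof. exact: extendK. Qed.

Lemma extend_map n m (h : (n <= m)%N) f : extend (evconst_map h f) = extend f.
Proof. exact/truncateK/constant_from_extend. Qed.

Lemma evconst_map_comp i j k (hij : (i <= j)%N) (hjk : (j <= k)%N)
  (hik : (i <= k)%N) f : evconst_map hjk (evconst_map hij f) = evconst_map hik f.
Proof. by rewrite {1}/evconst_map /= extend_map. Qed.

Lemma leq_directed i j : exists k, (i <= k)%N /\ (j <= k)%N.
Proof. by exists (maxn i j); rewrite leq_maxl leq_maxr. Qed.

Definition evconst_system : directed_system R :=
  @DirectedSystem R nat (fun i j => (i <= j)%N) leqnn
    (fun i j k ij => leq_trans ij) (inhabits 0%N) leq_directed
    (fun n => dsum R 'I_n.+1) evconst_map evconst_map_id evconst_map_comp.

(** The maps [extend] embed the system as an increasing chain of subsemimodules with union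
    [evconst], so a cocone glues to a single map: evaluate [g] at any rank from which the sequence
    is constant. *)
Lemma evconst_colimit :
  @is_colimit R evconst_system evconst (fun n => @extend n).
Proof.
split=> [n m h f|N g gP]; first exact: extend_map.
have g_indep n m (f : evconst) :
    constant_from n f -> constant_from m f ->
    g n (truncate n f) = g m (truncate m f).
  wlog nm : n m / (n <= m)%N => [IH fn fm|fn _].
    by case: (leqP n m) => [|/ltnW] nm; [|symmetry]; apply: IH.
  by rewrite -(gP n m nm) /= truncateK.
pose rank f := projT1 (cid (evconstP f)).
have rankP f : constant_from (rank f) f := projT2 (cid (evconstP f)).
pose u f := g (rank f) (truncate (rank f) f).
have uE n (f : evconst) : constant_from n f -> u f = g n (truncate n f).
  by move=> fn; apply: g_indep.
have u_lin : semilinear u.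
  split=> [a f|f f'].
    by rewrite (uE (rank f)) ?linearZ //; apply: constant_fromZ.
  (* Additivity of [u] is that of [g n] at a rank [n] common to both summands. *)
  pose n := maxn (rank f) (rank f').
  have fn : constant_from n f := constant_fromW (leq_maxl _ _) (@rankP f).
  have fn' : constant_from n f' := constant_fromW (leq_maxr _ _) (@rankP f').
  by rewrite !(uE n) ?linearD //; apply: constant_fromD.
pose uM := GRing.isSemilinear.Build R evconst N _ u u_lin.
pose uL : {linear evconst -> N} := HB.pack u uM.
exists uL; split=> [n f|v vP f] /=.
  by rewrite (uE n) ?extendK //; apply: constant_from_extend.
(* Uniqueness: [f] is itself the [extend] of its truncation at [rank f], where the cocone equation
   prescribes [v]. *)
by rewrite /u -vP /= truncateK.
Qed.

Lemma dsum_ord_fg n : finitely_generated (dsum R 'I_n).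
Proof.
exists n, (fun i => Dsum (finite_support_ord (fun j => (i == j)%:R))) => f.
exists f; apply: dsumP => j.
have coordD : {morph (fun g : dsum R 'I_n => g j) : g h / g + h} by [].
have coord0 : (0 : dsum R 'I_n) j = 0 by [].
rewrite (big_morph (fun g : dsum R 'I_n => g j) coordD coord0) /=.
rewrite (bigD1 j) //= eqxx mulr1 big1 ?addr0 // => i /negPf->.
by rewrite mulr0.
Qed.

Lemma evconst_flat : flat evconst.
Proof.
exists evconst_system, (fun n => @extend n); split; last exact: evconst_colimit.
move=> n; split; last exact: dsum_ord_fg.
by exists 'I_n.+1, idfun; exists idfun.
Qed.

(** * Eventually constant sequences are not projective *)

Lemma evconst1_subproof : `[< eventually_constant (fun=> 1) >].
Proof. by apply/asboolP; exists 0%N. Qed.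

Lemma pulse_subproof (b : bool) n :
  `[< eventually_constant (fun i => ((i == n) == b)%:R) >].
Proof.
by apply/asboolP; exists n.+1 => m nm; rewrite !gtn_eqF.
Qed.

(* The indicator of {n} for b = true, of its complement for b = false. *)
Definition pulse b n : evconst := Evconst (pulse_subproof b n).

Lemma pulseD n : pulse true n + pulse false n = Evconst evconst1_subproof.
Proof.
by apply: evconst_ext => i /=; case: (i == n); rewrite ?addr0 ?add0r.
Qed.

(** Elements supported in [s] are combinations of the basis vectors indexed by [s], so the largest
    rank of the images of these finitely many vectors serves for all [h]. *)
Lemma constant_from_finite_support (X : Type) (F : lSemiModType R)
    (f : {linear F -> dsum R X}) (p : {linear F -> evconst}) (s : seq X) :
  bijective f -> exists n, forall h : F,
    (forall x, f h x <> 0 -> List.In x s) -> constant_from n (p h).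
Proof.
case=> g fK gK; elim: s => [|y s [n IHs]].
  exists 0%N => h fh0; have -> : h = 0.
    apply: (can_inj fK); rewrite linear0; apply: dsumP => x.
    by apply: contrapT => /fh0.
  by rewrite linear0.
have delta_supp : `[< finite_support (fun x => `[< x = y >]%:R : R) >].
  apply/asboolP; exists [:: y] => x; case: asboolP => // -> _.
  by left.
have [m pm] := evconstP (p (g (Dsum delta_supp))).
exists (maxn n m) => h hs.
have rest_supp : `[< finite_support (fun x => if `[< x = y >] then 0 else f h x) >].
  apply/asboolP; exists (y :: s) => x; case: asboolP => // _; exact: hs.
pose r := g (Dsum rest_supp).
(* Without subtraction, the part of [h] away from [y] has to be built directly, by setting the
   coordinate at [y] to zero. *)
have -> : h = f h y *: g (Dsum delta_supp) + r.
  apply: (can_inj fK); rewrite linearD linearZ /= !gK; apply: dsumP => x /=.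
  by case: asboolP => [->|_]; rewrite ?mulr1 ?addr0 ?mulr0 ?add0r.
rewrite linearD linearZ; apply: constant_fromD.
  exact/constant_fromZ/(constant_fromW (leq_maxr _ _) pm).
apply: constant_fromW (leq_maxl _ _) (IHs _ _) => x.
rewrite gK /=; case: asboolP => // xy /hs[yx|//].
by case: xy.
Qed.

Lemma evconst_not_projective :
  (1 : R) != 0 -> zerosumfree R -> ~ projective evconst.
Proof.
move=> /eqP R_neq0 zsf [F [s [p [[X [f f_bij]] sK]]]].
have [Y YP] := dsum_supp (f (s (Evconst evconst1_subproof))).
have [n nP] := constant_from_finite_support p Y f_bij.
have: constant_from n (p (s (pulse true n))).
  (* Where the image of the constant sequence 1 has coordinate zero, so does that of its summand
     [pulse true n]. *)
  apply: nP => x fx; apply: YP => f1; apply: fx.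
  by move: f1; rewrite -(pulseD n) !linearD; apply: zsf.
(* Comparing the entries of the pulse at [n.+1] and [n] yields 0 = 1. *)
rewrite sK => /(_ n.+1 (leqnSn n)) /=.
by rewrite eqxx gtn_eqF // => /esym.
Qed.

Lemma not_left_perfect : (1 : R) != 0 -> zerosumfree R -> ~ left_perfect R.
Proof.
by move=> R_neq0 zsf /(_ _ evconst_flat); apply: evconst_not_projective.
Qed.

End EventuallyConstant.

Theorem theorem5p15 (R : pzSemiRingType)
    (R_proper : proper_semiring R) (R_simple : simple_semiring R) :
  ((exists w : R, infinite_element w) \/
   (exists I : submodClosed R^o,
      minimal_left_ideal I /\ projective (subsemimod I)) ->
   ~ left_perfect R) /\
  ((exists w : R, infinite_element w) \/
   (exists I : submodClosed (R^c)^o,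
      minimal_right_ideal I /\ projective (subsemimod I)) ->
   ~ right_perfect R).
Proof.
have zsf : zerosumfree R.
  by case: R_simple => ? _; apply: proper_ideal_simple_zerosumfree.
have R_neq0 : (1 : R) != 0.
  apply/eqP => R0; apply: R_proper => x; exists 0.
  by rewrite addr0 -[x]mulr1 R0 mulr0.
(* The right-hand half is the left-hand statement over [R^c], which shares its addition, 0 and 1
   with [R], so [zsf] and [R_neq0] carry over by conversion. *)
by split=> _; apply: not_left_perfect.
Qed.
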